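(* Let $q$ be a prime power and let $n$, $k\ge 1$ and $\ell\ge 0$ be integers such that $n=3\frac{q^k-1}{q-1}+\ell$. Then $$\gamma^{ID}(\mathbb{F}_q^n)\le q^{n-k}.$$
   Context: $\mathbb{F}_q$ is the finite field with $q$ elements. $\mathbb{F}_q^n$ is viewed as a graph in which two words are adjacent iff they differ in exactly one coordinate; this graph is isomorphic to $K_q^n$, the Cartesian product of $n$ copies of the complete graph $K_q$. $N[v]$ is the closed neighbourhood of $v$; a code is a nonempty set $C$ of vertices; $I(u)=N[u]\cap C$. A code $C$ is identifying in a graph if $I(u)\ne\emptyset$ for every vertex $u$ and $I(u)\neq I(v)$ for all distinct vertices $u,v$. $\gamma^{ID}(G)$ is the minimum cardinality of an identifying code in the finite graph $G$. *)

(* Defs.v *)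
From mathcomp Require Import all_boot all_order all_algebra.
Set Implicit Arguments.
Unset Strict Implicit.
Unset Printing Implicit Defensive.

Record sgraph := SGraph {
  vertex :> finType;
  adj : rel vertex;
  adj_sym : symmetric adj;
  adj_irr : irreflexive adj }.

Section IdentifyingCodes.
Variable G : sgraph.
Implicit Types (C : {set G}) (u v : G).

Definition closed_nbhd v : {set G} := [set u | (u == v) || adj v u].

Definition Iset C u : {set G} := closed_nbhd u :&: C.

Definition identifying C : bool :=
  [&& C != set0,
      [forall u : G, Iset C u != set0]
    & [forall u : G, forall v : G, (u != v) ==> (Iset C u != Iset C v)]].

(* If G has no identifying code (e.g. because of twins), this is #|G|.+1,
   which exceeds the cardinality of every set of vertices. *)
Definition gammaID : nat :=
  \big[minn/#|G|.+1]_(C : {set G} | identifying C) #|C|.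

Lemma gammaID_le C : identifying C -> gammaID <= #|C|.
Proof.
move=> idC; rewrite /gammaID; have := mem_index_enum C.
elim: (index_enum _) => // D s IHs; rewrite inE big_cons => /predU1P[<-|/IHs le].
  by rewrite idC geq_minl.
by case: ifP => // _; rewrite geq_min le orbT.
Qed.

Lemma gammaID_attained C :
  identifying C -> exists2 D : {set G}, identifying D & #|D| = gammaID.
Proof.
move=> idC.
have [D idD minD] := @arg_minnP _ C identifying (fun D => #|D|) idC.
exists D => //; apply/eqP; rewrite eqn_leq gammaID_le // andbT.
rewrite /gammaID; elim/big_ind: _ => //; first by rewrite ltnW // ltnS max_card.
by move=> x y lex ley; rewrite leq_min lex.
Qed.

End IdentifyingCodes.

Section HammingGraph.
Variables (F : finFieldType) (n : nat).

Definition hamming_adj : rel 'rV[F]_n :=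
  fun u v => #|[set i : 'I_n | u ord0 i != v ord0 i]| == 1.

Lemma hamming_adj_sym : symmetric hamming_adj.
Proof.
move=> u v; rewrite /hamming_adj; congr (#|pred_of_set _| == 1).
by apply/setP=> i; rewrite !inE eq_sym.
Qed.

Lemma hamming_adj_irr : irreflexive hamming_adj.
Proof.
move=> u; rewrite /hamming_adj (_ : [set i | _] = set0) ?cards0 //.
by apply/setP=> i; rewrite !inE eqxx.
Qed.

Definition hamming_graph : sgraph := SGraph hamming_adj_sym hamming_adj_irr.

End HammingGraph.

(* Main.v *)
Require Import Defs.
From mathcomp Require Import all_boot all_order all_algebra.

(** The code is the kernel of a parity-check matrix whose [n] rows are nonzero
    vectors of [F^k] and contain representatives of all the
    [(q^k - 1) / (q - 1)] lines of [F^k], each at least three times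
    ([parity_check_exists]). As no row is zero, two codewords never differ in
    exactly one coordinate. A word [u] outside the code has a nonzero syndrome;
    at least three rows are proportional to it, so [u] can be corrected to a
    codeword by changing coordinate [i] alone, for at least three values of
    [i]. Three such codewords have no common neighbour but [u], and this makes
    the code identifying ([identifying_of_three_directions]). Finally the
    syndrome map is onto [F^k], so its kernel has at most [q^(n - k)]
    elements ([card_kernel_le]). *)

Import GRing.Theory.

Section IdentifyingLinearCodes.

Local Open Scope ring_scope.

Local Set Implicit Arguments.
Local Unset Strict Implicit.

Variable F : finFieldType.

Lemma in_closed_nbhdP n (u v : 'rV[F]_n) :
  reflect (forall i j, u 0 i != v 0 i -> u 0 j != v 0 j -> i = j)
          (u \in @closed_nbhd (hamming_graph F n) v).
Proof.
have -> : (u \in @closed_nbhd (hamming_graph F n) v)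
          = (#|[set i | (u 0 i != v 0 i)%R]| <= 1)%N.
  rewrite inE /= hamming_adj_sym /hamming_adj.
  rewrite leq_eqVlt ltnS leqn0 orbC cards_eq0.
  congr (_ || _); apply/eqP/eqP => [->|/setP uv].
    by apply/setP=> i; rewrite !inE eqxx.
  apply/matrixP=> a i; rewrite (ord1 a); apply/eqP.
  by have := uv i; rewrite !inE => /negbFE.
apply: (iffP idP) => [/card_le1_eqP uv i j ui uj|uv].
  by apply: uv; rewrite inE.
by apply/card_le1_eqP=> i j; rewrite !inE => ui uj; apply: uv.
Qed.

Definition correctable n (C : {set 'rV[F]_n}) (u : 'rV[F]_n) : {set 'I_n} :=
  [set i | [exists c : F, u + c *: delta_mx 0 i \in C]].

Lemma shiftE n (u : 'rV[F]_n) c i j :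
  (u + c *: delta_mx 0 i) 0 j = u 0 j + c * (i == j)%:R.
Proof. by rewrite !mxE eqxx eq_sym. Qed.

Lemma shift_closed_nbhd n (u : 'rV[F]_n) c i :
  u + c *: delta_mx 0 i \in @closed_nbhd (hamming_graph F n) u.
Proof.
apply/in_closed_nbhdP=> a b; rewrite !shiftE.
case: (i =P a) => [<-|_]; last by rewrite mulr0 addr0 eqxx.
by case: (i =P b) => [//|_]; rewrite mulr0 addr0 eqxx.
Qed.

(** If [v] differs from [u] at [j], then a codeword obtained from [u] by
    changing [i != j] also differs from [v] at [j], hence only there, and so
    [v] takes the changed value at [i]. Two such directions [i] cannot both
    occur, and three directions leave two that are different from [j]. *)
Lemma Iset_neq n (C : {set 'rV[F]_n}) (u v : 'rV[F]_n) :
  u \notin C -> (2 < #|correctable C u|)%N -> u != v ->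
  @Iset (hamming_graph F n) C u != @Iset (hamming_graph F n) C v.
Proof.
move=> uC three /eqP uv; apply/eqP=> eqI.
have [j uvj] : exists j, u 0 j != v 0 j.
  apply/existsP; rewrite -negb_forall; apply/forallP=> euv; apply: uv.
  by apply/matrixP=> a i; rewrite (ord1 a); apply/eqP.
have near_v i c : u + c *: delta_mx 0 i \in C ->
    u + c *: delta_mx 0 i \in @closed_nbhd (hamming_graph F n) v.
  move=> wC; have : u + c *: delta_mx 0 i \in @Iset (hamming_graph F n) C v.
    by rewrite -eqI inE shift_closed_nbhd.
  by rewrite inE => /andP[].
have agree i c a : u + c *: delta_mx 0 i \in C -> i != j -> a != j ->
    v 0 a = u 0 a + c * (i == a)%:R.
  move=> /near_v/in_closed_nbhdP/(_ j a) near ij aj.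
  apply/eqP; rewrite eq_sym; apply: contraNT aj => neq.
  rewrite [a == j]eq_sym; apply/eqP/near; last by rewrite shiftE.
  by rewrite shiftE (negPf ij) mulr0 addr0.
have /card_gt1P[a [b [aA bA ab]]] : (1 < #|correctable C u :\ j|)%N.
  have := cardsD1 j (correctable C u).
  by move: three => /[swap] ->; case: (j \in _) => // /ltnW.
move: aA bA; rewrite !inE => /andP[aj /existsP[c cC]] /andP[bj /existsP[d dC]].
have := agree _ _ a dC bj aj.
rewrite (agree _ _ a cC aj aj) eqxx mulr1 eq_sym (negPf ab) mulr0.
move=> /addrI c0; move: uC; rewrite -[u]addr0 -(scale0r (delta_mx 0 a)) -{1}c0.
by rewrite cC.
Qed.

Lemma identifying_of_three_directions n (C : {set 'rV[F]_n}) :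
    C != set0 ->
    {in C &, forall u v, u \in @closed_nbhd (hamming_graph F n) v -> u = v} ->
    (forall u, u \notin C -> (2 < #|correctable C u|)%N) ->
  @identifying (hamming_graph F n) C.
Proof.
move=> C0 sep three; apply/and3P; split=> //.
  apply/forallP=> u; apply/set0Pn; have [uC|uC] := boolP (u \in C).
    by exists u; rewrite inE uC inE eqxx.
  have /card_gt0P[i] := ltnW (ltnW (three u uC)).
  rewrite inE => /existsP[c cC]; exists (u + c *: delta_mx 0 i).
  by rewrite inE cC shift_closed_nbhd.
apply/forallP=> u; apply/forallP=> v; apply/implyP=> uv.
have [uC|uC] := boolP (u \in C); last exact: (Iset_neq uC (three u uC)).
have [vC|vC] := boolP (v \in C); last first.
  by rewrite eq_sym (Iset_neq vC (three v vC)) 1?eq_sym.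
apply: contraNneq uv => /setP/(_ u); rewrite !inE eqxx uC /= andbT => eqI.
by apply/eqP/sep => //; rewrite inE -eqI.
Qed.

(** Nonzero scaling is an equivalence relation on the [q^k - 1] nonzero
    vectors, with classes of size [q - 1]; the list is a transversal. *)
Lemma line_representatives k :
  exists s : seq 'rV[F]_k,
    [/\ size s = ((#|F| ^ k - 1) %/ (#|F| - 1))%N,
        {in s, forall w, w != 0} &
        forall v, v != 0 -> exists2 w, w \in s & exists c, v = c *: w].
Proof.
pose D : {set 'rV[F]_k} := ~: [set 0].
pose R (u v : 'rV[F]_k) := [exists c : F, (c != 0) && (v == c *: u)].
have eqR : {in D & &, equivalence_rel R}.
  move=> x y z _ _ _; split.
    by apply/existsP; exists 1; rewrite oner_eq0 scale1r eqxx.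
  case/existsP=> c /andP[c0 /eqP ->].
  apply/existsP/existsP=> -[d /andP[d0 /eqP ->]].
    by exists (d / c); rewrite mulf_neq0 ?invr_eq0 // scalerA divfK ?eqxx.
  by exists (d * c); rewrite mulf_neq0 // scalerA eqxx.
have partP := equivalence_partitionP eqR.
set P := equivalence_partition R D in partP.
have cardP B : B \in P -> #|B| = (#|F| - 1)%N.
  case/imsetP=> x xD ->; move: xD; rewrite !inE => x0.
  have inj : injective (fun c : F => c *: x).
    move=> c d /eqP; rewrite -subr_eq0 -scalerBl scaler_eq0 (negPf x0) orbF.
    by rewrite subr_eq0 => /eqP.
  have -> : [set y in D | R x y] = [set c *: x | c in ~: [set (0 : F)]].
    apply/setP=> y; rewrite !inE; apply/andP/imsetP.
      by case=> _ /existsP[c /andP[c0 /eqP ->]]; exists c; rewrite ?inE.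
    case=> c; rewrite !inE => c0 ->; split.
      by rewrite scaler_eq0 negb_or c0.
    by apply/existsP; exists c; rewrite c0 eqxx.
  by rewrite card_imset // cardsC1 subn1.
have trT := transversalP partP.
exists (enum (transversal P D)); split.
- rewrite -cardE (card_transversal trT).
  have := card_uniform_partition cardP partP.
  rewrite cardsC1 card_mx mul1n -subn1 => ->.
  by rewrite mulnK // subn_gt0 card_finNzRing_gt1.
- move=> w; rewrite mem_enum => /(subsetP (transversal_sub trT)).
  by rewrite !inE.
move=> v v0; have vD : v \in D by rewrite !inE.
have BP : pblock P v \in P by rewrite pblock_mem // (cover_partition partP).
have wT := repr_mem_transversal trT 0 BP.
have wB := repr_mem_pblock trT 0 BP.
have wD := subsetP (transversal_sub trT) _ wT.
exists (transversal_repr 0 (transversal P D) (pblock P v)).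
  by rewrite mem_enum.
move: wB; rewrite pblock_equivalence_partition // => /existsP[c /andP[c0]].
by move/eqP=> ->; exists c^-1; rewrite scalerA mulVf // scale1r.
Qed.

Definition proportional_rows n k (H : 'M[F]_(n, k)) (s : 'rV[F]_k) :=
  [set i : 'I_n | [exists c : F, s == c *: row i H]].

(** Row [i] is the representative of index [i %/ 3], so that the one of index
    [j] occurs at [3j], [3j + 1] and [3j + 2]. The remaining rows are filled
    with a default vector that must not vanish, whence [0 < k]: a zero row
    would create two codewords at distance one. *)
Lemma parity_check_exists n k : (0 < k)%N ->
    (3 * ((#|F| ^ k - 1) %/ (#|F| - 1)) <= n)%N ->
  exists H : 'M[F]_(n, k),
    (forall i, row i H != 0) /\
    (forall s, s != 0 -> (2 < #|proportional_rows H s|)%N).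
Proof.
move=> k_gt0 len; have [reps [sz reps0 cover]] := line_representatives k.
pose h (i : 'I_n) : 'rV[F]_k := nth (const_mx 1) reps (i %/ 3).
exists (\matrix_(i < n) h i); split=> [i|s /cover[w w_in [c ->]]].
  rewrite rowK /h; have [lt|ge] := ltnP (i %/ 3) (size reps).
    exact/reps0/mem_nth.
  rewrite nth_default //; apply/eqP=> /matrixP/(_ 0 (Ordinal k_gt0)).
  by rewrite !mxE => /eqP; rewrite oner_eq0.
have lt_n (r : 'I_3) : (3 * index w reps + r < n)%N.
  apply: leq_trans len; rewrite -sz; have := ltn_ord r; move: w_in.
  rewrite -index_mem => lt_sz lt_r; apply: (@leq_trans (3 * (index w reps).+1)).
    by rewrite mulnS addnC -addSn leq_add2r.
  by rewrite leq_mul2l.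
pose g (r : 'I_3) := Ordinal (lt_n r).
have g_inj : injective g by move=> r t [/addnI /val_inj].
suff sub : g @: [set: 'I_3] \subset
    proportional_rows (\matrix_(i < n) h i) (c *: w).
  by have := subset_leq_card sub; rewrite card_imset // cardsT card_ord.
apply/subsetP=> _ /imsetP[r _ ->]; rewrite inE; apply/existsP; exists c.
by rewrite rowK /h /= mulnC divnMDl // divn_small // addn0 nth_index.
Qed.

Definition kernel n k (H : 'M[F]_(n, k)) : {set 'rV[F]_n} :=
  [set u | u *m H == 0].

(** Adding to each codeword a fixed preimage of each syndrome gives pairwise
    distinct words of [F^n]. *)
Lemma card_kernel_le n k (H : 'M[F]_(n, k)) :
    (k <= n)%N -> (forall s, exists u : 'rV_n, u *m H = s) ->
  (#|kernel H| <= #|F| ^ (n - k))%N.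
Proof.
move=> le_kn onto.
have /fin_all_exists[f fH] := onto.
pose g (x : 'rV[F]_n * 'rV[F]_k) := x.1 + f x.2.
have g_inj : {in setX (kernel H) [set: 'rV[F]_k] &, injective g}.
  move=> [c s] [d t]; rewrite !inE /= !andbT => /eqP cH /eqP dH.
  rewrite /g /= => eg; have := congr1 (fun u : 'rV[F]_n => u *m H) eg.
  rewrite !mulmxDl cH dH !fH !add0r => est; move: eg; rewrite est.
  by move/addIr=> ->.
have := max_card (g @: setX (kernel H) [set: 'rV[F]_k]).
rewrite (card_in_imset g_inj) cardsX cardsT !card_mx !mul1n.
rewrite -[X in (_ <= _ ^ X)%N -> _](subnK le_kn) expnD leq_pmul2r // expn_gt0.
by rewrite (ltnW (card_finNzRing_gt1 F)).
Qed.

Lemma shift_mulmx n k (H : 'M[F]_(n, k)) (u : 'rV[F]_n) c i :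
  (u + c *: delta_mx 0 i) *m H = u *m H + c *: row i H.
Proof. by rewrite mulmxDl -scalemxAl -rowE. Qed.

Lemma kernel_identifying n k (H : 'M[F]_(n, k)) :
    (forall i, row i H != 0) ->
    (forall s, s != 0 -> (2 < #|proportional_rows H s|)%N) ->
  @identifying (hamming_graph F n) (kernel H).
Proof.
move=> row0 three; apply: identifying_of_three_directions.
- by apply/set0Pn; exists 0; rewrite inE mul0mx.
- move=> u v uC vC /in_closed_nbhdP near.
  move: uC vC; rewrite !inE => /eqP uH /eqP vH.
  apply/eqP; apply: contraT => uv.
  have [i uvi] : exists i, u 0 i != v 0 i.
    apply/existsP; rewrite -negb_forall; apply: contra uv => /forallP euv.
    by apply/eqP/matrixP=> a i; rewrite (ord1 a); apply/eqP.
  have def_u : u = v + (u 0 i - v 0 i) *: delta_mx 0 i.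
    apply/matrixP=> a j; rewrite (ord1 a) shiftE.
    case: (i =P j) => [<-|/eqP ij]; first by rewrite mulr1 addrC subrK.
    rewrite mulr0 addr0; apply/eqP; apply: contraNT ij => uvj.
    exact/eqP/near.
  move: uH; rewrite def_u shift_mulmx vH add0r => /eqP.
  by rewrite scaler_eq0 (negPf (row0 i)) orbF subr_eq0 (negPf uvi).
move=> u; rewrite inE => /three lt2; apply: leq_trans lt2 _.
apply/subset_leq_card/subsetP=> i; rewrite !inE => /existsP[c /eqP uH].
by apply/existsP; exists (- c); rewrite inE shift_mulmx uH scaleNr subrr.
Qed.

Lemma syndrome_onto n k (H : 'M[F]_(n, k)) :
    (forall s, s != 0 -> (2 < #|proportional_rows H s|)%N) ->
  forall s, exists u : 'rV_n, u *m H = s.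
Proof.
move=> three s; have [->|/three lt2] := eqVneq s 0.
  by exists 0; rewrite mul0mx.
have /card_gt0P[i] := ltnW (ltnW lt2); rewrite inE => /existsP[c /eqP ->].
by exists (0 + c *: delta_mx 0 i); rewrite shift_mulmx mul0mx add0r.
Qed.

End IdentifyingLinearCodes.

(** [(q^k - 1) / (q - 1) = 1 + q + ... + q^(k-1)] has [k] positive terms. This
    gives [k <= n], so that the truncated difference [n - k] is a true one. *)
Lemma leq_card_lines q k : 1 < q -> k <= (q ^ k - 1) %/ (q - 1).
Proof.
move=> q_gt1; rewrite leq_divRL ?subn_gt0 // !subn1 predn_exp mulnC leq_mul2l.
rewrite -[X in X <= _]card_ord -sum1_card; apply/orP; right.
by apply: leq_sum => i _; rewrite expn_gt0 ltnW.
Qed.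

Theorem mainTheorem5 (p e q : nat) (p_prime : prime p) (e_gt0 : 0 < e)
    (q_def : q = p ^ e) (F : finFieldType) (cardF : #|F| = q)
    (n k l : nat) (k_ge1 : 1 <= k)
    (n_def : n = 3 * ((q ^ k - 1) %/ (q - 1)) + l) :
  gammaID (hamming_graph F n) <= q ^ (n - k).
Proof.
have le_n : 3 * ((#|F| ^ k - 1) %/ (#|F| - 1)) <= n.
  by rewrite cardF n_def leq_addr.
have le_kn : k <= n.
  apply: leq_trans le_n.
  apply: leq_trans (leq_card_lines #|F| k (card_finNzRing_gt1 F)) _.
  by rewrite leq_pmull.
have [H [row0 three]] := parity_check_exists k_ge1 le_n.
apply: leq_trans (gammaID_le _) _; first exact: kernel_identifying row0 three.
rewrite -cardF; exact/card_kernel_le/syndrome_onto.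
Qed.
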